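(* Let $k\in\{2,3\}$ and consider the sequence of Hamming graphs $H(k,m)$, $m\to\infty$, with $n=m^k$ vertices. Let $\mathbf{p}^t(v,v)$ be the return probability after $t$ steps of the non-backtracking random walk on $H(k,m)$. Then $$\limsup_{n}\ n^{1/3}\sum_{t=1}^{n^{1/3}} t\,\mathbf{p}^t(v,v)<\infty ,$$ and, for every sequence $\epsilon=\epsilon(n)>0$ such that $\epsilon(n)=o(1)$ but $\epsilon(n)n^{1/3}\to\infty$, with $r=\epsilon^{-1}\big[\log(n\epsilon^3)-3\log\log(n\epsilon^3)\big]$, $$\limsup_{n}\ \epsilon^{-1}r\sum_{t=1}^{2r}\big[(1+\epsilon)^{t\wedge r}-1\big]\mathbf{p}^t(v,v)=0 .$$
   Context: The Hamming graph $H(k,m)$ has vertex set $\{0,\dots,m-1\}^k$, and two vertices are joined by an edge if and only if they differ in precisely one coordinate. It is vertex-transitive with $n=m^k$ vertices and vertex degree $d(n)=k(m-1)$. Limits superior are along $n=m^k$, $m\to\infty$. $t\wedge r=\min(t,r)$. The non-backtracking random walk on a graph started at $v$: the first step goes to a uniformly chosen neighbor of $v$; at every later step, having just traversed an edge from $x$ to $y$, the walk moves to a uniformly chosen neighbor of $y$ other than $x$. $\mathbf{p}^t(v,v)$ is the probability that this walk, started at $v$, is at $v$ after $t$ steps; by transitivity it does not depend on $v$. Sums with non-integer upper limits run over the integers not exceeding the limit; quantities such as $r$ are considered only for $n$ large enough that they are defined and positive. *)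

(* Defs.v *)
From HB Require Import structures.
From mathcomp Require Import all_boot all_order all_algebra.
From mathcomp Require Import all_classical all_reals all_analysis.

Set Implicit Arguments.
Unset Strict Implicit.
Unset Printing Implicit Defensive.

Import Order.TTheory GRing.Theory Num.Theory.
Local Open Scope ring_scope.

Definition hamming_vertex (k m : nat) : finType := {ffun 'I_k -> 'I_m}.

Definition hamming (k m : nat) : rel (hamming_vertex k m) :=
  fun x y => #|[set i | x i != y i]%SET| == 1%N.

Section NonBacktrackingWalk.
Variables (R : realType) (T : finType) (e : rel T).

Definition nbhd (x : T) : {set T} := [set y | e x y]%SET.

(* Transition probability of the step y -> z of the walk whose previous step
   was x -> y.  If y has no neighbour other than x the walk is stuck and this
   is 0; that never occurs when all degrees are at least 2. *)
Definition nbw_step (x y z : T) : R :=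
  if z \in (nbhd y :\ x)%SET then #|(nbhd y :\ x)%SET|%:R^-1 else 0.

(* With X_0 = v, X_1, X_2, ... the non-backtracking walk,
   nbw_edge v t x y is the probability that X_t = x and X_(t+1) = y. *)
Fixpoint nbw_edge (v : T) (t : nat) : T -> T -> R :=
  match t with
  | 0%N => fun x y =>
      if (x == v) && (y \in nbhd v) then #|nbhd v|%:R^-1 else 0
  | s.+1 => fun y z => \sum_(x : T) nbw_edge v s x y * nbw_step x y z
  end.

Definition nbw_prob (t : nat) (v w : T) : R :=
  if t is s.+1 then \sum_(x : T) nbw_edge v s x w else (v == w)%:R.

End NonBacktrackingWalk.

(* Main.v *)
Require Import Defs.
From HB Require Import structures.
From mathcomp Require Import all_boot all_order all_algebra.
From mathcomp Require Import all_classical all_reals all_analysis.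
From mathcomp Require Import ring lra zify.
Set Implicit Arguments.
Unset Strict Implicit.
Unset Printing Implicit Defensive.
Import Order.TTheory GRing.Theory Num.Theory.
Import numFieldNormedType.Exports.
Local Open Scope classical_set_scope.
Local Open Scope ring_scope.

(** Up to a factor d / (d - 1) per step the non-backtracking walk is dominated
    by the simple random walk, where d = k (M - 1), and up to a further factor
    k M / d by the chain which rerandomizes one uniformly chosen coordinate; for
    at most M steps these factors multiply up to a constant.  For a set S of
    coordinates let N_t(S) be M^-|S| times the probability that X_t agrees with
    the starting point off S.  One step back in time enlarges S by a random
    coordinate, so with rho = (k - 1) / k, by induction on t,
    N_t(S) <= c^t (M^-k + rho^t |~: S| / M) for nonempty S, and hence
    p^t(v, v) <= C (1 / n + rho^t / M) for 1 <= t <= M.  Since n^(1/3) <= M, the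
    first claim follows by summation.  For the second, put L = ln (n e^3), which
    tends to infinity; since e r = L - 3 ln L, the 1 / n part contributes
    O(r^2 e^(-1) e^(e r) / n) = O(1 / L) and the rho^t / M part
    O(r / M) = O(L / (e n^(1/3))) = O(1 / L). *)

(** * Comparison of the non-backtracking walk with the simple random walk *)

Section NonBacktrackingBound.
Variables (R : realType) (T : finType) (e : rel T) (v : T).

Lemma nbw_edge_ge0 t x y : 0 <= nbw_edge R e v t x y.
Proof.
elim: t x y => [|t IH] x y /=; first by case: ifP.
apply: sumr_ge0 => z _; apply: mulr_ge0 => //.
by rewrite /nbw_step; case: ifP.
Qed.

Lemma nbw_prob_ge0 t w : 0 <= nbw_prob R e t v w.
Proof. by case: t => [|t] //=; apply: sumr_ge0 => x _; exact: nbw_edge_ge0. Qed.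

Variable d : nat.
Hypotheses (d_gt0 : (0 < d)%N) (deg_gt : forall y, (d < #|nbhd e y|)%N).

(** Given the last edge into [y], at most one neighbour of [y] is excluded, so a degree above [d]
    leaves at least [d] equally likely continuations. *)
Lemma nbw_edge_le t y z :
  nbw_edge R e v t y z <= if e y z then d%:R^-1 * nbw_prob R e t v y else 0.
Proof.
have inv_le c : (d <= c)%N -> c%:R^-1 <= d%:R^-1 :> R.
  by move=> h; rewrite lef_pV2 ?posrE ?ltr0n ?ler_nat // (leq_trans d_gt0).
case: t => [|t] /=.
  rewrite eq_sym; case: eqVneq => [<-|_] /=; last by case: ifP; rewrite ?mulr0.
  by rewrite inE; case: ifP => // _; rewrite mulr1 inv_le// ltnW.
rewrite mulr_sumr.
have -> : (if e y z then \sum_x d%:R^-1 * nbw_edge R e v t x y else 0)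
    = \sum_x (if e y z then d%:R^-1 * nbw_edge R e v t x y else 0) :> R.
  by case: ifP; rewrite // big1.
apply: ler_sum => x _; rewrite /nbw_step !inE.
case: (e y z); last by rewrite andbF mulr0.
have d0 : 0 <= d%:R^-1 :> R by rewrite invr_ge0.
rewrite andbT mulrC; apply: ler_wpM2r; first exact: nbw_edge_ge0.
case: ifP => // _; apply: inv_le.
have := deg_gt y; rewrite (cardsD1 x); case: (x \in _) => /=; lia.
Qed.

Lemma nbw_prob_le t z :
  nbw_prob R e t.+1 v z <= d%:R^-1 * \sum_(y | e y z) nbw_prob R e t v y.
Proof.
rewrite mulr_sumr big_mkcond /=; apply: ler_sum => y _; exact: nbw_edge_le.
Qed.

End NonBacktrackingBound.

(** * Return probabilities on Hamming graphs through subcubes *)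

Section HammingGraph.
(* Gives set0, setT and subsetP their meaning for finite sets. *)
Import mathcomp.boot.fintype mathcomp.boot.finset.
Variables (k M : nat).
Local Notation V := (hamming_vertex k M).

Definition agree_off (v : V) (S : {set 'I_k}) : {set V} :=
  [set z : V | [forall i, (i \notin S) ==> (z i == v i)]]%SET.

Lemma agree_offP (v : V) (S : {set 'I_k}) (z : V) :
  reflect (forall i, i \notin S -> z i = v i) (z \in agree_off v S).
Proof.
rewrite inE; apply: (iffP forallP) => h i.
  by move=> iS; apply/eqP; exact: (implyP (h i)).
by apply/implyP => /h ->.
Qed.

Lemma agree_off0 (v : V) : agree_off v set0 = [set v]%SET.
Proof.
apply/setP => z; rewrite [RHS]inE; apply/agree_offP/eqP => [h|-> //].
by apply/ffunP => i; apply: h; rewrite inE.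
Qed.

Definition upd (y : V) (i : 'I_k) (a : 'I_M) : V :=
  [ffun j => if j == i then a else y j].

Lemma card_hamming_nbhd (y : V) : (k * M.-1 <= #|nbhd (@hamming k M) y|)%N.
Proof.
pose P := [set ia : 'I_k * 'I_M | ia.2 != y ia.1]%SET.
have diff i a j : (y j != upd y i a j) = (j == i) && (a != y i).
  by rewrite ffunE; case: (eqVneq j i) => [->|_]; [rewrite eq_sym|rewrite eqxx].
have injP : {in P &, injective (fun ia => upd y ia.1 ia.2)}.
  move=> [i a] [j b]; rewrite !inE /= => ai bj eqf.
  have := diff i a i; rewrite eqf diff eqxx ai bj andbT /= => /eqP ij; subst j.
  by congr (_, _); have /ffunP/(_ i) := eqf; rewrite !ffunE eqxx.
have <- : #|P| = (k * M.-1)%N.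
  rewrite -sum1_card (eq_bigl (fun ia => true && (ia.2 != y ia.1))); last first.
    by move=> ia; rewrite inE.
  rewrite -(pair_big_dep xpredT (fun i a => a != y i) (fun _ _ => 1%N)) /=.
  rewrite (eq_bigr (fun=> M.-1)) ?sum_nat_const ?card_ord //.
  by move=> i _; rewrite sum1_card cardC1 card_ord.
rewrite -(card_in_imset injP); apply: subset_leq_card.
apply/subsetP => z /imsetP[[i a]]; rewrite !inE /= => ai ->.
rewrite /hamming; apply/eqP; rewrite -(cards1 i); apply: eq_card => j.
by rewrite !inE diff ai andbT.
Qed.

(* A neighbour of y lying in agree_off v S arises by changing one coordinate i
   of y: freely when i \in S, and to the prescribed value v i otherwise. *)
Lemma card_nbhd_agree_off (v : V) (S : {set 'I_k}) (y : V) :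
  (#|[set z in agree_off v S | hamming y z]%SET| <=
   \sum_i (y \in agree_off v (i |: S)) * (if i \in S then M else 1))%N.
Proof.
(* [F i] may also contain [y] itself, which is why a free coordinate counts [M] values rather than
   [M - 1]. *)
pose F i := agree_off v S :&: agree_off y [set i].
apply: (@leq_trans (\sum_z \sum_i (z \in F i))).
  rewrite -sum1_card big_mkcond /=; apply: leq_sum => z _.
  rewrite inE; case: ifP => // /andP[zS /cards1P[i yz]].
  rewrite (bigD1 i)//= inE zS /= (_ : z \in _ = true) //.
  by apply/agree_offP => j; rewrite -yz inE negbK => /eqP.
rewrite exchange_big /=; apply: leq_sum => i _.
have -> : (\sum_z (z \in F i) = #|F i|)%N by rewrite -sum1_card [RHS]big_mkcond.
have [->|[z0]] := set_0Vmem (F i); first by rewrite cards0.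
rewrite inE => /andP[/agree_offP z0S /agree_offP z0y].
have -> : y \in agree_off v (i |: S).
  apply/agree_offP => j; rewrite in_setU1 negb_or => /andP[ji jS].
  by rewrite -z0S // z0y // inE.
have zE z : z \in F i -> z = upd y i (z i).
  rewrite inE => /andP[_ /agree_offP zy]; apply/ffunP => j; rewrite ffunE.
  by case: eqVneq => [->//|ji]; rewrite zy // inE.
rewrite mul1n; case: ifP => iS.
  rewrite -[X in (_ <= X)%N]card_ord -cardsT.
  apply: leq_trans (leq_imset_card (upd y i) setT).
  by apply: subset_leq_card; apply/subsetP => z /zE ->; apply: imset_f.
apply: leq_trans (_ : #|[set upd y i (v i)]%SET| <= _)%N; last by rewrite cards1.
apply: subset_leq_card; apply/subsetP => z zF.
have := zF; rewrite [_ \in F i]inE => /andP[/agree_offP zS _].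
by have /zE -> := zF; rewrite zS ?iS // inE.
Qed.

Variables (R : realType) (v : V) (d : nat).
Hypotheses (d_gt0 : (0 < d)%N) (d_lt : (d < k * M.-1)%N).

(* P(X_t agrees with v off S), divided by the probability of this event under
   the uniform distribution of the coordinates in S *)
Definition agree_ratio (t : nat) (S : {set 'I_k}) : R :=
  M%:R ^- #|S| * \sum_(z in agree_off v S) nbw_prob R (@hamming k M) t v z.

(** The normalization makes all coordinates alike: [i \in S] has [M] choices, while for [i \notin S]
    the single choice is offset by [#|i |: S| = #|S| + 1]. *)
Lemma agree_ratioS t S :
  agree_ratio t.+1 S <= M%:R / d%:R * \sum_i agree_ratio t (i |: S).
Proof.
have M_gt0 : (0 < M)%N by case: (M) d_lt; rewrite ?muln0.
have d0 : 0 <= d%:R^-1 :> R by rewrite invr_ge0.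
have deg y : (d < #|nbhd (@hamming k M) y|)%N.
  by apply: leq_trans (card_hamming_nbhd y).
have step : \sum_(z in agree_off v S) nbw_prob R (@hamming k M) t.+1 v z <=
    d%:R^-1 * \sum_y nbw_prob R (@hamming k M) t v y *
      #|[set z in agree_off v S | hamming y z]%SET|%:R.
  apply: le_trans (ler_sum _ (fun z _ => nbw_prob_le R v d_gt0 deg t z)) _.
  rewrite -mulr_sumr (exchange_big_dep xpredT) //= ler_wpM2l //.
  apply: ler_sum => y _; rewrite sumr_const mulr_natr.
  rewrite (@eq_card _ _ (mem [set z in agree_off v S | hamming y z]%SET)) //.
  by move=> z; rewrite [RHS]inE.
rewrite /agree_ratio; apply: le_trans (ler_wpM2l _ step) _.
  by rewrite invr_ge0 exprn_ge0.
rewrite mulrCA [M%:R / _]mulrC -[leRHS]mulrA ler_wpM2l //.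
have step2 : \sum_y nbw_prob R (@hamming k M) t v y *
      #|[set z in agree_off v S | hamming y z]%SET|%:R <=
   \sum_i (if i \in S then M else 1%N)%:R *
     \sum_(y in agree_off v (i |: S)) nbw_prob R (@hamming k M) t v y.
  under [leRHS]eq_bigr do rewrite mulr_sumr.
  rewrite (exchange_big_dep xpredT) //=; apply: ler_sum => y _.
  under eq_bigr do rewrite mulrC.
  rewrite -mulr_sumr ler_wpM2l ?nbw_prob_ge0 //.
  apply: le_trans (_ : (\sum_i (y \in agree_off v (i |: S)) *
      (if i \in S then M else 1))%:R <= _).
    by rewrite ler_nat card_nbhd_agree_off.
  rewrite natr_sum [leRHS]big_mkcond /=; apply: ler_sum => i _.
  by case: (y \in _); rewrite ?mul1n ?mul0n.
apply: le_trans (ler_wpM2l _ step2) _.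
  by rewrite invr_ge0 exprn_ge0.
rewrite !mulr_sumr; apply: ler_sum => i _; rewrite !mulrA ler_wpM2r //.
  by apply: sumr_ge0 => y _; exact: nbw_prob_ge0.
rewrite cardsU1; case: ifP => iS /=; first by rewrite mulrC.
by rewrite add1n exprS invfM mulr1 mulrA divff ?mul1r // pnatr_eq0 -lt0n.
Qed.

(** Each [i] outside [S] removes one element. On average over [i] the size shrinks by (k - 1) / k,
    the source of the decay rate. *)
Lemma sum_card_setU1C (S : {set 'I_k}) :
  (\sum_(i < k) #|~: (i |: S)| = k.-1 * #|~: S|)%N.
Proof.
have aux a c l : (a + c = l * c -> a = l.-1 * c)%N by case: l => [|l] /=; lia.
have h i : (#|~: (i |: S)| + (i \in ~: S) = #|~: S|)%N.
  have := cardsC (i |: S); rewrite cardsU1 inE.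
  have := cardsC S; case: (i \in S) => /=; lia.
have : (\sum_i (#|~: (i |: S)| + (i \in ~: S)) = k * #|~: S|)%N.
  by under eq_bigr do rewrite h; rewrite sum_nat_const card_ord.
by rewrite big_split /= -[X in (_ + X)%N]big_mkcond /= sum1_card => /aux.
Qed.

(** [M ^- k] does not depend on [S], and [#|~: S|] is an eigenfunction of averaging over [i], so the
    recursion reproduces the bound exactly. *)
Lemma agree_ratio_le t S : S != set0 ->
  agree_ratio t S <= (k%:R * M%:R / d%:R) ^+ t *
    (M%:R ^- k + (k.-1%:R / k%:R) ^+ t * #|~: S|%:R / M%:R).
Proof.
have k_gt0 : (0 < k)%N by case: (k) d_lt.
have M_gt0 : (0 < M)%N by case: (M) d_lt; rewrite ?muln0.
have M0 : 0 < M%:R :> R by rewrite ltr0n.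
elim: t S => [|t IH] S S0.
  rewrite !expr0 !mul1r /agree_ratio /=.
  rewrite (bigD1 v) /=; last by apply/agree_offP.
  rewrite eqxx big1 ?addr0 ?mulr1; last first.
    by move=> i /andP[_ /negbTE]; rewrite eq_sym => ->.
  have := cardsC S; rewrite card_ord => cS.
  (* A full [S] gives the uniform term; otherwise both [S] and its complement are nonempty, and
     [M ^- #|S|] is at most 1 / M. *)
  case: (posnP #|~: S|) => [c0|cpos].
    have -> : #|S| = k by move: cS; rewrite c0 addn0.
    by rewrite c0 mul0r addr0.
  rewrite -[leLHS]add0r lerD // ?invr_ge0 ?exprn_ge0 //.
  apply: le_trans (_ : M%:R^-1 <= _); last first.
    by rewrite ler_peMl ?invr_ge0 // ler1n.
  rewrite lef_pV2 ?posrE ?exprn_gt0 // -[leLHS]expr1 ler_weXn2l ?ler1n //.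
  by rewrite card_gt0.
apply: le_trans (agree_ratioS t S) _.
apply: le_trans (ler_wpM2l _ (ler_sum _ (fun i _ => IH (i |: S) _))) _.
- by rewrite divr_ge0.
- by move=> *; apply/set0Pn; eexists; exact: setU11.
rewrite -mulr_sumr big_split /= sumr_const card_ord -mulr_suml -mulr_sumr.
rewrite -natr_sum sum_card_setU1C natrM.
have k0 : k%:R != 0 :> R by rewrite pnatr_eq0 -lt0n.
have d0 : d%:R != 0 :> R by rewrite pnatr_eq0 -lt0n.
rewrite !exprS -[M%:R ^- k *+ k]mulr_natl le_eqVlt; apply/orP; left; apply/eqP.
have := gt_eqF M0 => /negbT; move: (M%:R ^- k) (_ ^+ t) (_ ^+ t) => Mk c rho MM0.
by field; rewrite k0 d0 MM0.
Qed.

(** One step back leads from the empty set to singletons, where [agree_ratio_le] applies; hence the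
    factor [k.-1] and the exponent [t] of the decay. *)
Lemma nbw_return_le t :
  nbw_prob R (@hamming k M) t.+1 v v <= (k%:R * M%:R / d%:R) ^+ t.+1 *
    (M%:R ^- k + (k.-1%:R / k%:R) ^+ t * k.-1%:R / M%:R).
Proof.
have k_gt0 : (0 < k)%N by case: (k) d_lt.
have k0 : k%:R != 0 :> R by rewrite pnatr_eq0 -lt0n.
have d0 : d%:R != 0 :> R by rewrite pnatr_eq0 -lt0n.
have -> : nbw_prob R (@hamming k M) t.+1 v v = agree_ratio t.+1 set0.
  by rewrite /agree_ratio cards0 expr0 invr1 mul1r agree_off0 big_set1.
apply: le_trans (agree_ratioS t set0) _.
have h i : agree_ratio t (i |: set0) <= (k%:R * M%:R / d%:R) ^+ t *
    (M%:R ^- k + (k.-1%:R / k%:R) ^+ t * k.-1%:R / M%:R).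
  have -> : k.-1 = #|~: (i |: (set0 : {set 'I_k}))|.
    by rewrite setU0 cardsC1 card_ord.
  have {1}-> : #|~: (i |: (set0 : {set 'I_k}))| = k.-1.
    by rewrite setU0 cardsC1 card_ord.
  by apply: agree_ratio_le; apply/set0Pn; exists i; rewrite setU11.
apply: le_trans (ler_wpM2l _ (ler_sum _ (fun i _ => h i))) _.
  by rewrite divr_ge0.
rewrite sumr_const card_ord -[_ *+ k]mulr_natl exprS.
move: (M%:R ^- k + _) (_ ^+ t) => X c.
by rewrite le_eqVlt; apply/orP; left; apply/eqP; field.
Qed.

End HammingGraph.

(** * Limits superior and elementary inequalities *)

Lemma limn_esup_lty (R : realType) (u : nat -> R) (C : R) :
  (\forall m \near \oo, u m <= C) -> (limn_esup (EFin \o u) < +oo)%E.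
Proof.
move=> uC; apply: (@le_lt_trans _ _ C%:E); last exact: ltry.
rewrite /limn_esup limf_esupE.
apply: (@le_trans _ _ (ereal_sup ((EFin \o u) @` [set m | u m <= C]))).
  by apply: ereal_inf_lbound; exists [set m | u m <= C].
by apply: ge_ereal_sup => _ [m /= h <-]; rewrite lee_fin.
Qed.

Lemma cvg0_limn_esup (R : realType) (u : nat -> R) :
  u @ \oo --> (0 : R) -> limn_esup (EFin \o u) = 0%E.
Proof.
move=> u0; have h : (EFin \o u) @ \oo --> 0%E by apply: cvg_EFin => //; exact: nearW.
rewrite is_cvg_limn_esupE; first exact/cvg_lim.
by apply/cvg_ex; exists 0%E.
Qed.

(** 12 = q / (1 - q)^2 at q = 3 / 4 is the full series. This q leaves room for (1 + e) (2 / 3) with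
    e <= 1 / 8. *)
Lemma sum_arith_geom_le (R : realType) N :
  \sum_(1 <= t < N.+1) t%:R * (3 / 4) ^+ t <= 12 :> R.
Proof.
have -> : \sum_(1 <= t < N.+1) t%:R * (3 / 4) ^+ t =
    12 - (4 * N%:R + 16) * (3 / 4) ^+ N.+1 :> R.
  elim: N => [|N IH]; first by rewrite big_geq // expr1; field.
  rewrite big_nat_recr //= IH !exprS -!natr1.
  by move: (_ ^+ N) => x; field.
by rewrite gerBl mulr_ge0 ?exprn_ge0.
Qed.

(** The factor [x] on the right later cancels the prefactor 1 / eps of the second claim. *)
Lemma expn1D_sub1_le (R : realType) (x : R) t :
  0 <= x -> (1 + x) ^+ t - 1 <= t%:R * x * (1 + x) ^+ t.
Proof.
move=> x0; elim: t => [|t IH]; first by rewrite expr0 subrr mul0r mul0r.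
have h : 0 <= x * (t%:R * x * (1 + x) ^+ t + x * (1 + x) ^+ t).
  by rewrite mulr_ge0 // addr_ge0 // !mulr_ge0 // exprn_ge0; lra.
rewrite exprS -natr1; move: IH h; move: (_ ^+ t) => c IH h.
nra.
Qed.

Lemma powR1D_le_expR (R : realType) (x u : R) :
  0 <= x -> 0 <= u -> (1 + x) `^ u <= expR (x * u).
Proof.
move=> x0 u0; rewrite expRM; apply: ge0_ler_powR => //.
- by rewrite nnegrE addr_ge0.
- by rewrite nnegrE expR_ge0.
- exact: expR_ge1Dx.
Qed.

(** * Explicit bounds at a fixed size [M], for [k] equal to 2 or 3 *)

Lemma return_prob_le (R : realType) (k M : nat) (v : hamming_vertex k M) t :
  k = 2%N \/ k = 3%N -> (3 <= M)%N -> (0 < t)%N -> (t <= M)%N ->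
  nbw_prob R (@hamming k M) t v v <=
    expR 4 * (M%:R ^- k + 3 * (2 / 3) ^+ t / M%:R).
Proof.
move=> hk M_ge3; case: t => // t _ tM.
have M3 : 3 <= M%:R :> R by rewrite ler_nat.
have M0 : M%:R != 0 :> R by rewrite pnatr_eq0; lia.
(* The bound is applied with [d] equal to the degree minus one. *)
have d_gt0 : (0 < (k * M.-1).-1)%N by case: hk => ->; lia.
have dlt : ((k * M.-1).-1 < k * M.-1)%N by lia.
apply: le_trans (nbw_return_le R v d_gt0 dlt t) _.
have cle : k%:R * M%:R / (k * M.-1).-1%:R <= 1 + 4 / M%:R :> R.
  have dE : (k * M.-1).-1%:R = k%:R * (M%:R - 1) - 1 :> R.
    have -> : (k * M.-1)%N.-1 = (k * (M - 1) - 1)%N by rewrite !subn1.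
    rewrite natrB ?natrM ?natrB //; first by lia.
    by case: hk => ->; lia.
  rewrite ler_pdivrMr ?ltr0n // {}dE.
  rewrite -subr_ge0.
  (* For M >= 3 the numerator is at least 3 (3 k - 1) - 4 (k + 1) = 5 k - 7 > 0. *)
  have -> : (1 + 4 / M%:R) * (k%:R * (M%:R - 1) - 1) - k%:R * M%:R =
     ((3 * k%:R - 1) * M%:R - 4 * (k%:R + 1)) / M%:R :> R by field.
  clear d_gt0 dlt; apply: divr_ge0 => //; case: hk => ->; lra.
apply: ler_pM.
- by rewrite exprn_ge0 // divr_ge0 // mulr_ge0.
- apply: addr_ge0; first by rewrite invr_ge0 exprn_ge0.
  by rewrite divr_ge0 // mulr_ge0 // exprn_ge0.
(* since t.+1 <= M, c ^ t.+1 <= (1 + 4 / M) ^ t.+1 <= expR 4 *)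
- apply: (@le_trans _ _ (expR (4 / M%:R) ^+ t.+1)).
    apply: lerXn2r; rewrite ?nnegrE ?expR_ge0 //.
    exact: le_trans cle (expR_ge1Dx _).
  rewrite -expRM_natr ler_expR mulrAC ler_pdivrMr ?ler_pM2l ?ler_nat //; lra.
rewrite lerD2l ler_pM2r ?invr_gt0; last by lra.
(* For both values of [k], (k - 1) / k <= 2 / 3 and k - 1 <= 2. *)
have -> : 3 * (2 / 3) ^+ t.+1 = (2 / 3) ^+ t * 2 :> R.
  by rewrite exprS; move: (_ ^+ t) => x; field.
apply: ler_pM; rewrite ?exprn_ge0 ?divr_ge0 //.
  by apply: lerXn2r; rewrite ?nnegrE ?divr_ge0 //; case: hk => -> /=; lra.
by case: hk => ->; rewrite ?ler_nat.
Qed.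

(** This keeps every [t] up to n^(1/3) within the range [t <= M] of [return_prob_le]. *)
Lemma cbrt_le (R : realType) (k M : nat) (b : R) :
  (k <= 3)%N -> (0 < M)%N -> 0 <= b -> b ^+ 3 = M%:R ^+ k -> b <= M%:R.
Proof.
move=> k3 M_gt0 b_ge0 bE.
rewrite -(@ler_pXn2r _ 3) ?nnegrE // bE.
by rewrite ler_weXn2l // ler1n.
Qed.

(** 37 = 1 + 36: the 1 / n part gives b^3 / n = 1, the geometric part 3 * 12 * b / M <= 36. *)
Lemma sum_t_return_le (R : realType) (k M : nat) (v : hamming_vertex k M) (b : R) :
  k = 2%N \/ k = 3%N -> (3 <= M)%N -> 0 <= b -> b ^+ 3 = M%:R ^+ k ->
  b * \sum_(1 <= t < (Num.truncn b).+1) t%:R * nbw_prob R (@hamming k M) t v v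
    <= 37 * expR 4.
Proof.
move=> hk M_ge3 b_ge0 bE.
have M3 : 3 <= M%:R :> R by rewrite ler_nat.
have M0 : M%:R != 0 :> R by rewrite pnatr_eq0; lia.
have bM : b <= M%:R.
  by apply: cbrt_le bE => //; [case: hk => -> | lia].
have Nb : (Num.truncn b)%:R <= b by rewrite truncn_le.
have K0 : 0 <= expR 4 :> R := expR_ge0 _.
have n0 : 0 < M%:R ^+ k :> R by rewrite exprn_gt0 //; lra.
set K := expR 4 in K0 *.
set N := Num.truncn b in Nb *.
have term t : (1 <= t < N.+1)%N -> t%:R * nbw_prob R (@hamming k M) t v v <=
    b * K / M%:R ^+ k + 3 * K / M%:R * (t%:R * (3 / 4) ^+ t).
  move=> /andP[t1 tN].
  have tb : t%:R <= b by apply: le_trans Nb; rewrite ler_nat.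
  have tM : (t <= M)%N by rewrite -(ler_nat R); lra.
  apply: le_trans (ler_wpM2l _ (return_prob_le R v hk M_ge3 t1 tM)) _ => //.
  rewrite -/K mulrDr mulrDr; apply: lerD.
    by rewrite -mulrA ler_wpM2r // mulr_ge0 // invr_ge0 ltW.
  have pw : (2 / 3) ^+ t <= (3 / 4) ^+ t :> R.
    by apply: lerXn2r; rewrite ?nnegrE; lra.
  have -> : t%:R * (K * (3 * (2 / 3) ^+ t / M%:R)) =
     3 * K / M%:R * (t%:R * (2 / 3) ^+ t) by move: (_ ^+ t) => x; field.
  by rewrite ler_wpM2l ?divr_ge0 ?mulr_ge0 // ler_wpM2l.
rewrite big_nat; apply: le_trans (ler_wpM2l b_ge0 (ler_sum _ term)) _.
rewrite -big_nat big_split /= sumr_const_nat subn1 /= -mulr_sumr.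
rewrite -[_ *+ N]mulr_natr.
have S12 := sum_arith_geom_le R N.
have h1 : b * K / M%:R ^+ k * N%:R <= b * K / M%:R ^+ k * b.
  by rewrite ler_wpM2l // divr_ge0 ?mulr_ge0 // ltW.
have h2 : 3 * K / M%:R * \sum_(1 <= t < N.+1) t%:R * (3 / 4) ^+ t <=
    3 * K / M%:R * 12.
  by rewrite ler_wpM2l // divr_ge0 ?mulr_ge0.
apply: le_trans (ler_wpM2l b_ge0 (lerD h1 h2)) _.
have -> : b * (b * K / M%:R ^+ k * b + 3 * K / M%:R * 12) =
   b ^+ 3 / M%:R ^+ k * K + 36 * K * (b / M%:R).
  by move: n0 => /gt_eqF/negbT; move: (_ ^+ k) => n n0; field; rewrite n0 M0.
rewrite bE divff ?gt_eqF // mul1r.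
have : b / M%:R <= 1 by rewrite ler_pdivrMr ?mul1r //; lra.
by move: (b / M%:R) => x x1; nra.
Qed.

(** For [r < 0] the truncation makes the sum empty; otherwise all brackets are nonnegative. *)
Lemma supercritical_sum_ge0 (R : realType) (k M : nat) (v : hamming_vertex k M)
    (e r : R) : 0 < e ->
  0 <= e^-1 * r *
    \sum_(1 <= t < (Num.truncn (2 * r)).+1)
      ((1 + e) `^ (Num.min t%:R r) - 1) * nbw_prob R (@hamming k M) t v v.
Proof.
move=> e_gt0; have [r0|r0] := ltP r 0.
  have /truncn0Pn -> : ~~ (1 <= 2 * r) by rewrite -ltNge; lra.
  by rewrite big_geq // mulr0.
apply: mulr_ge0; first by rewrite mulr_ge0 // invr_ge0 ltW.
rewrite big_nat; apply: sumr_ge0 => t _; rewrite mulr_ge0 ?nbw_prob_ge0 //.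
rewrite subr_ge0 -[leLHS](powRr0 (1 + e)) ler_powR ?le_min ?r0 ?ler0n //; lra.
Qed.

(** The bracket is bounded by [expR w], uniformly in [t], against the 1 / n part, and by t e (1 +
    e)^t against the geometric part. *)
Lemma supercritical_sum_le (R : realType) (k M : nat) (v : hamming_vertex k M)
    (b e L r : R) :
  k = 2%N \/ k = 3%N -> (3 <= M)%N -> 0 <= b -> b ^+ 3 = M%:R ^+ k ->
  0 < e -> e <= 1 / 8 -> L = ln (M%:R ^+ k * e ^+ 3) -> 72 <= L ->
  r = e^-1 * (L - 3 * ln L) ->
  e^-1 * r *
    \sum_(1 <= t < (Num.truncn (2 * r)).+1)
      ((1 + e) `^ (Num.min t%:R r) - 1) * nbw_prob R (@hamming k M) t v v
  <= 650 * expR 4 / L.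
Proof.
move=> hk M_ge3 b_ge0 bE e_gt0 e_le LE L_ge r_def.
have K0 : 0 <= expR 4 :> R := expR_ge0 _.
have M3 : 3 <= M%:R :> R by rewrite ler_nat.
have M0 : M%:R != 0 :> R by rewrite pnatr_eq0; lia.
have bM : b <= M%:R.
  by apply: cbrt_le bE => //; [case: hk => -> | lia].
have n0 : 0 < M%:R ^+ k :> R by rewrite exprn_gt0 //; lra.
set K := expR 4 in K0 *.
have [r0|r0] := ltP r 0.
  have /truncn0Pn -> : ~~ (1 <= 2 * r) by rewrite -ltNge; lra.
  by rewrite big_geq // mulr0 divr_ge0 ?mulr_ge0 //; lra.
set y := e * b.
have y0 : 0 <= y by rewrite mulr_ge0 // ltW.
have ne0 : 0 < M%:R ^+ k * e ^+ 3 by rewrite mulr_gt0 // exprn_gt0.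
have yE : expR L = y ^+ 3.
  by rewrite LE lnK ?posrE // -bE /y exprMn mulrC.
have yE' : y = expR (L / 3).
  apply/eqP; rewrite -(@eqrXn2 _ 3) ?expR_ge0 // -yE -expRM_natr.
  by rewrite divfK.
(* From x^2 / 2 <= exp x at x = L / 3. *)
have yL : L ^+ 2 <= 18 * y.
  have := @expR_ge1Dxn _ (L / 3) 1; rewrite -yE' expr_div_n.
  by have -> : 2`!%:R = 2 :> R by []; move=> /(_ ltac:(lra)); lra.
(* Since [72 * L <= L ^+ 2 <= 18 * y]. It yields 2 r <= M below, as 2 e r <= 2 L <= e b <= e M. *)
have Ly : 2 * L <= y by nra.
have lnL0 : 0 <= ln L by rewrite ln_ge0 //; lra.
set w := L - 3 * ln L.
have rE : r = w / e by rewrite r_def mulrC.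
have w0 : 0 <= w by move: r0; rewrite rE pmulr_lge0 // invr_gt0.
have wL : w <= L by rewrite /w; lra.
(* The correction 3 ln L in [r] produces 1 / L^3, which beats the factor w^2 <= L^2 of the 1 / n
   part. *)
have ew : expR w = M%:R ^+ k * e ^+ 3 / L ^+ 3.
  rewrite /w expRB -[3 * ln L]mulrC expRM_natr lnK ?posrE; last by lra.
  by rewrite LE lnK ?posrE.
have rM : 2 * r <= M%:R.
  rewrite rE mulrA ler_pdivrMr //.
  by move: Ly; rewrite /y; nra.
have Nr : (Num.truncn (2 * r))%:R <= 2 * r by rewrite truncn_le mulr_ge0.
set N := Num.truncn (2 * r) in Nr *.
have term t : (1 <= t < N.+1)%N ->
    ((1 + e) `^ (Num.min t%:R r) - 1) * nbw_prob R (@hamming k M) t v v <=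
    expR w * K / M%:R ^+ k + 3 * K * e / M%:R * (t%:R * (3 / 4) ^+ t).
  move=> /andP[t1 tN].
  have tM : (t <= M)%N.
    by rewrite -(ler_nat R); apply: le_trans rM; apply: le_trans Nr; rewrite ler_nat.
  set u := Num.min _ _.
  have u0 : 0 <= u by rewrite le_min r0 ler0n.
  have u1 : 0 <= (1 + e) `^ u - 1.
    by rewrite subr_ge0 -[leLHS](powRr0 (1 + e)) ler_powR //; lra.
  have ur : (1 + e) `^ u - 1 <= expR w.
    have h : (1 + e) `^ u <= expR w.
      apply: le_trans (powR1D_le_expR (ltW e_gt0) u0) _.
      by rewrite ler_expR mulrC -ler_pdivlMr // -rE ge_min lexx orbT.
    lra.
  have ut : (1 + e) `^ u - 1 <= t%:R * e * (1 + e) ^+ t.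
    apply: le_trans (expn1D_sub1_le _ (ltW e_gt0)).
    rewrite lerD2r -powR_mulrn; last by lra.
    by rewrite ler_powR ?ge_min ?lexx //; lra.
  apply: le_trans (ler_wpM2l u1 (return_prob_le R v hk M_ge3 t1 tM)) _.
  rewrite -/K mulrDr mulrDr; apply: lerD.
    by rewrite mulrA ler_wpM2r ?invr_ge0 ?(ltW n0) // ler_wpM2r.
  apply: (@le_trans _ _ (t%:R * e * (1 + e) ^+ t * (K * (3 * (2 / 3) ^+ t / M%:R)))).
    by rewrite ler_wpM2r // mulr_ge0 // divr_ge0 // mulr_ge0 // exprn_ge0.
  (* 1 + e <= 9 / 8, and (9 / 8) (2 / 3) = 3 / 4. *)
  have pw : ((1 + e) * (2 / 3)) ^+ t <= (3 / 4) ^+ t.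
    by apply: lerXn2r; rewrite ?nnegrE; lra.
  have -> : t%:R * e * (1 + e) ^+ t * (K * (3 * (2 / 3) ^+ t / M%:R)) =
     3 * K * e / M%:R * (t%:R * ((1 + e) * (2 / 3)) ^+ t).
    by rewrite [(_ * (2 / 3)) ^+ t]exprMn; move: (_ ^+ t) (_ ^+ t) => x x'; field.
  rewrite ler_wpM2l ?ler_wpM2l // divr_ge0 // !mulr_ge0 //; lra.
rewrite big_nat.
have er0 : 0 <= e^-1 * r by rewrite mulr_ge0 // invr_ge0 ltW.
apply: le_trans (ler_wpM2l er0 (ler_sum _ term)) _.
rewrite -big_nat big_split /= sumr_const_nat subn1 /= -mulr_sumr.
rewrite -[_ *+ N]mulr_natr.
have S12 := sum_arith_geom_le R N.
have h1 : expR w * K / M%:R ^+ k * N%:R <= expR w * K / M%:R ^+ k * (2 * r).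
  by rewrite ler_wpM2l // divr_ge0 ?(ltW n0) // mulr_ge0 // expR_ge0.
have h2 : 3 * K * e / M%:R * \sum_(1 <= t < N.+1) t%:R * (3 / 4) ^+ t <=
    3 * K * e / M%:R * 12.
  by rewrite ler_wpM2l // divr_ge0 // !mulr_ge0 //; lra.
apply: le_trans (ler_wpM2l er0 (lerD h1 h2)) _.
have -> : e^-1 * r * (expR w * K / M%:R ^+ k * (2 * r) + 3 * K * e / M%:R * 12) =
   2 * K * w ^+ 2 / L ^+ 3 + 36 * K * w / (e * M%:R).
  rewrite rE ew; move: n0 => /gt_eqF/negbT; move: (M%:R ^+ k) => n n0.
  by field; rewrite n0 M0 !gt_eqF //; lra.
(* 650 = 2 + 36 * 18, with 18 from [yL]. *)
have -> : 650 * K / L = 2 * K * L ^+ 2 / L ^+ 3 + 36 * K * (18 / L).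
  by field; rewrite gt_eqF //; lra.
apply: lerD.
  rewrite ler_wpM2r ?invr_ge0 ?exprn_ge0 //; first by lra.
  rewrite ler_wpM2l ?mulr_ge0 // lerXn2r // nnegrE; lra.
rewrite -mulrA ler_wpM2l ?mulr_ge0 //.
have eM : y <= e * M%:R by rewrite ler_wpM2l // ltW.
rewrite ler_pdivrMr; last by rewrite mulr_gt0 //; lra.
rewrite mulrAC ler_pdivlMr; last by lra.
apply: le_trans (_ : L ^+ 2 <= _); first by rewrite expr2 ler_wpM2r //; lra.
by apply: le_trans yL _; rewrite ler_wpM2l.
Qed.

(** * Passage to the limit along [M = m.+1] *)

Theorem theorem6 (R : realType) (k : nat) (hk : k = 2%N \/ k = 3%N)
    (v : forall m : nat, hamming_vertex k m.+1) :
  let n (m : nat) : nat := (m.+1 ^ k)%N in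
  let p (m t : nat) : R := nbw_prob R (@hamming k m.+1) t (v m) (v m) in
  let cbrt (m : nat) : R := (n m)%:R `^ (3%:R^-1) in
  (limn_esup (fun m : nat =>
     (cbrt m *
       \sum_(1 <= t < (Num.truncn (cbrt m)).+1) t%:R * p m t)%:E) < +oo)%E
  /\
  (forall eps : nat -> R,
     (forall m : nat, 0 < eps (n m)) ->
     eps (n m) @[m --> \oo] --> (0 : R) ->
     eps (n m) * cbrt m @[m --> \oo] --> +oo ->
     let r (m : nat) : R :=
       (eps (n m))^-1 * (ln ((n m)%:R * eps (n m) ^+ 3)
                         - 3%:R * ln (ln ((n m)%:R * eps (n m) ^+ 3))) in
     limn_esup (fun m : nat =>
       ((eps (n m))^-1 * r m *
         \sum_(1 <= t < (Num.truncn (2%:R * r m)).+1)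
           ((1 + eps (n m)) `^ (Num.min t%:R (r m)) - 1) * p m t)%:E) = 0%E).
Proof.
move=> n p cbrt.
have cbrt_ge0 m : 0 <= cbrt m by exact: powR_ge0.
have cbrtE m : cbrt m ^+ 3 = m.+1%:R ^+ k.
  by rewrite -powR_mulrn // -powRrM mulVf // powRr1 // natrX.
split.
  apply: (@limn_esup_lty R (fun m => cbrt m * _) (37 * expR 4)).
  exists 2%N => // m /= m2.
  exact: sum_t_return_le.
move=> eps eps_gt0 eps0 eps_cbrt r.
apply: (@cvg0_limn_esup R (fun m => (eps (n m))^-1 * r m * _)).
apply/cvgrPdist_le => d d_gt0.
(* L >= A gives both the hypothesis [72 <= L] and 650 exp(4) / L <= d. *)
pose A : R := Num.max 72 (650 * expR 4 / d).
near=> m.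
have M_ge3 : (3 <= m.+1)%N by near: m; exists 2%N.
have e_le : eps (n m) <= 1 / 8.
  apply: (le_trans (ler_norm _)); rewrite -normrN -sub0r.
  by near: m; move/cvgrPdist_le: eps0 => /(_ (1 / 8)); apply; lra.
have y_ge : expR A <= eps (n m) * cbrt m.
  by near: m; move/cvgryPge: eps_cbrt; apply.
have e_gt0 := eps_gt0 m; set e := eps (n m) in e_le y_ge e_gt0 *.
have A72 : 72 <= A by rewrite le_max lexx.
(* As n e^3 is the cube of e n^(1/3), its logarithm is 3 ln (e n^(1/3)) >= 3 A >= A. *)
have L_ge : A <= ln (m.+1%:R ^+ k * e ^+ 3).
  have y_gt0 : 0 < e * cbrt m by apply: lt_le_trans y_ge; exact: expR_gt0.
  rewrite -cbrtE mulrC -exprMn lnXn // -mulr_natr.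
  have : A <= ln (e * cbrt m) by rewrite -[A]expRK ler_ln ?posrE ?expR_gt0.
  lra.
rewrite sub0r normrN ger0_norm; last exact: supercritical_sum_ge0.
have L72 := le_trans A72 L_ge.
apply: le_trans (supercritical_sum_le (v m) hk M_ge3 (cbrt_ge0 m) (cbrtE m)
  e_gt0 e_le erefl L72 _) _.
  by rewrite /r /n natrX.
rewrite ler_pdivrMr; last by lra.
rewrite [d * _]mulrC -ler_pdivrMr //; apply: le_trans L_ge.
by rewrite le_max lexx orbT.
Unshelve. all: by end_near.
Qed.
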